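(* Let $k$ be a commutative ring with unit, and let $(H,A,C)$ be a Doi-Koppinen datum over $k$, i.e. $H$ is a Hopf algebra, $A$ a left $H$-comodule algebra and $C$ a right $H$-module coalgebra. Suppose that there exists a total integral $\gamma : C\to \mathrm{Hom}(C,A)$ of $(H,A,C)$. Then for any $M\in {}^C\mathcal{M}(H)_A$ the map $$f: C\otimes A\otimes M\to M,\qquad f(c\otimes a\otimes m)=\sum m_{<0>}\,\gamma\bigl(c\cdot S(a_{<-1>})\bigr)(m_{<-1>})\,a_{<0>}$$ for all $c\in C$, $a\in A$, $m\in M$, is a $k$-split epimorphism in ${}^C\mathcal{M}(H)_A$. In particular, $C\otimes A$ is a generator in the category ${}^C\mathcal{M}(H)_A$.
   Context: Throughout $\otimes$ and $\mathrm{Hom}$ are over $k$, $S$ is the antipode of $H$, and Sweedler notation is used: $\Delta(c)=\sum c_{(1)}\otimes c_{(2)}$; left coactions are written $\rho_M(m)=\sum m_{<-1>}\otimes m_{<0>}$. A left $H$-comodule algebra is an algebra $A$ with a left $H$-coaction $\rho_A:A\to H\otimes A$ that is an algebra map. A right $H$-module coalgebra is a coalgebra $C$ with a right $H$-action such that $\Delta(c\cdot h)=\sum c_{(1)}\cdot h_{(1)}\otimes c_{(2)}\cdot h_{(2)}$ and $\varepsilon(c\cdot h)=\varepsilon(c)\varepsilon(h)$. ${}^C\mathcal{M}(H)_A$ is the category of (right-left) Doi-Koppinen modules: $k$-modules $M$ with a right $A$-action and a left $C$-coaction $\rho_M$ such that $\rho_M(ma)=\sum m_{<-1>}\cdot a_{<-1>}\otimes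 m_{<0>}a_{<0>}$ for all $m\in M,a\in A$; morphisms are the $A$-linear and $C$-colinear maps. An integral of $(H,A,C)$ is a $k$-linear map $\gamma:C\to\mathrm{Hom}(C,A)$ such that for all $c,d\in C$ $$\sum c_{(1)}\otimes\gamma(c_{(2)})(d)=\sum d_{(2)}\cdot\{\gamma(c)(d_{(1)})\}_{<-1>}\otimes\{\gamma(c)(d_{(1)})\}_{<0>};$$ it is total if $\sum\gamma(c_{(1)})(c_{(2)})=\varepsilon(c)1_A$ for all $c\in C$. $C\otimes A$ is an object of ${}^C\mathcal{M}(H)_A$ via $(c\otimes a)b=\sum c\cdot b_{<-1>}\otimes ab_{<0>}$ and coaction $c\otimes a\mapsto\sum c_{(1)}\otimes c_{(2)}\otimes a$. $C\otimes A\otimes M$ is an object of ${}^C\mathcal{M}(H)_A$ via the structures of $C\otimes A$: $(c\otimes a\otimes m)b=\sum c\cdot b_{<-1>}\otimes ab_{<0>}\otimes m$ and coaction $c\otimes a\otimes m\mapsto\sum c_{(1)}\otimes c_{(2)}\otimes a\otimes m$. A $k$-split epimorphism in ${}^C\mathcal{M}(H)_A$ is a morphism of ${}^C\mathcal{M}(H)_A$ that has a $k$-linear section. *)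

(* Defs.v *)
From HB Require Import structures.
From mathcomp Require Import all_boot all_algebra.
From mathcomp Require Import generic_quotient boolp.
Set Implicit Arguments.
Unset Strict Implicit.
Unset Printing Implicit Defensive.
Import GRing.Theory.
Local Open Scope ring_scope.
Local Open Scope quotient_scope.

Reserved Notation "x ⊗ y" (at level 40, left associativity).
Reserved Notation "x ∙ y" (at level 40, left associativity).
Reserved Notation "\tsum_ ( x , y <- t ) F"
  (at level 41, F at level 41, x binder, y binder,
   format "'[' \tsum_ ( x ,  y  <-  t ) '/  '  F ']'").

(* [M ⊗ N] is the quotient of the free commutative monoid on [M * N] (a word
   [:: (x1, y1); ..; (xn, yn)] stands for the sum of the xi ⊗ yi) by the
   congruence generated by k-bilinearity; opposites come for free, since
   -(x ⊗ y) = (- x) ⊗ y. *)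
Section Tensor.
Context {k : comPzRingType}.
Variables M N : lmodType k.

Inductive tensor_rel : seq (M * N) -> seq (M * N) -> Prop :=
| TRrefl s : tensor_rel s s
| TRsym s t : tensor_rel s t -> tensor_rel t s
| TRtrans s t u : tensor_rel s t -> tensor_rel t u -> tensor_rel s u
| TRcat s s' t t' :
    tensor_rel s s' -> tensor_rel t t' -> tensor_rel (s ++ t) (s' ++ t')
| TRcatC s t : tensor_rel (s ++ t) (t ++ s)
| TRaddl x x' y : tensor_rel [:: (x + x', y)] [:: (x, y); (x', y)]
| TRaddr x y y' : tensor_rel [:: (x, y + y')] [:: (x, y); (x, y')]
| TR0 y : tensor_rel [:: (0, y)] [::]
| TRscale (a : k) x y : tensor_rel [:: (a *: x, y)] [:: (x, a *: y)].

Definition tensor_relb : rel (seq (M * N)) := fun s t => `[< tensor_rel s t >].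

Lemma tensor_relb_equiv : equiv_class_of tensor_relb.
Proof.
split=> [s|s t|t s u].
- by apply/asboolP; apply: TRrefl.
- by apply/asboolP/asboolP; apply: TRsym.
- by move=> /asboolP h1 /asboolP h2; apply/asboolP; apply: TRtrans h1 h2.
Qed.

Canonical tensor_equiv := EquivRelPack tensor_relb_equiv.
Record tensor := Tensor { tensor_val : {eq_quot tensor_equiv} }.
HB.instance Definition _ := [isNew for tensor_val].
HB.instance Definition _ := [Choice of tensor by <:].

Definition tclass (s : seq (M * N)) : tensor :=
  Tensor (\pi_{eq_quot tensor_equiv} s).
Definition trepr (t : tensor) : seq (M * N) := repr (tensor_val t).

Lemma tclassP s t : reflect (tensor_rel s t) (tclass s == tclass t).
Proof.
apply: (iffP eqP) => [[] /eqmodP/asboolP // | h].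
by congr Tensor; apply/eqmodP/asboolP.
Qed.

Lemma treprK : cancel trepr tclass.
Proof. by case=> q; rewrite /tclass /trepr reprK. Qed.

Let clsP s t : tensor_rel s t -> tclass s = tclass t.
Proof. by move=> h; apply/eqP/tclassP. Qed.

Let repr_rel s : tensor_rel (trepr (tclass s)) s.
Proof. by apply/tclassP; rewrite treprK. Qed.

Definition tensor_zero : tensor := tclass [::].
Definition tensor_add (x y : tensor) : tensor := tclass (trepr x ++ trepr y).
Definition tensor_scale (a : k) (x : tensor) : tensor :=
  tclass [seq (a *: p.1, p.2) | p <- trepr x].
Definition tensor_opp (x : tensor) : tensor := tensor_scale (-1) x.

Let addE s t : tensor_add (tclass s) (tclass t) = tclass (s ++ t).
Proof. by apply: clsP; apply: TRcat; apply: repr_rel. Qed.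

Let rel_scale a s t : tensor_rel s t ->
  tensor_rel [seq (a *: p.1, p.2) | p <- s] [seq (a *: p.1, p.2) | p <- t].
Proof.
elim=> {s t} /=.
- by move=> s; apply: TRrefl.
- by move=> s t _; apply: TRsym.
- by move=> s t u _ h1 _; apply: TRtrans.
- by move=> s s' t t' _ h1 _ h2; rewrite !map_cat; apply: TRcat.
- by move=> s t; rewrite !map_cat; apply: TRcatC.
- by move=> x x' y; rewrite scalerDr; apply: TRaddl.
- by move=> x y y'; apply: TRaddr.
- by move=> y; rewrite scaler0; apply: TR0.
- by move=> b x y; rewrite scalerA mulrC -scalerA; apply: TRscale.
Qed.

Let scaleE a s : tensor_scale a (tclass s) = tclass [seq (a *: p.1, p.2) | p <- s].
Proof. by apply: clsP; apply: rel_scale; apply: repr_rel. Qed.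

Let addA : associative tensor_add.
Proof.
by move=> x y z; rewrite -[x]treprK -[y]treprK -[z]treprK !addE catA.
Qed.

Let addC : commutative tensor_add.
Proof.
by move=> x y; rewrite -[x]treprK -[y]treprK !addE; apply: clsP; apply: TRcatC.
Qed.

Let add0 : left_id tensor_zero tensor_add.
Proof. by move=> x; rewrite -[x]treprK addE. Qed.

Let rel_scaleD a b s : tensor_rel [seq ((a + b) *: p.1, p.2) | p <- s]
  ([seq (a *: p.1, p.2) | p <- s] ++ [seq (b *: p.1, p.2) | p <- s]).
Proof.
elim: s => [|[x y] s ih] /=; first exact: TRrefl.
rewrite scalerDl -cat1s.
apply: TRtrans (TRcat (TRaddl _ _ _) ih) _ => /=.
apply: TRcat (TRrefl [:: (a *: x, y)]) _.
set u := map _ s; set v := map _ s.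
rewrite -cat1s catA -[_ :: v]cat1s catA.
exact: TRcat (TRcatC _ _) (TRrefl _).
Qed.

Let rel_scale0 s : tensor_rel [seq ((0 : k) *: p.1, p.2) | p <- s] [::].
Proof.
elim: s => [|[x y] s ih] /=; first exact: TRrefl.
by rewrite scale0r -cat1s; apply: TRcat (TR0 _) ih.
Qed.

Let addN : left_inverse tensor_zero tensor_opp tensor_add.
Proof.
move=> x; rewrite /tensor_opp -[x]treprK scaleE addE.
have e : trepr x = [seq (1 *: p.1, p.2) | p <- trepr x].
  by rewrite -[LHS]map_id; apply: eq_map => -[u v] /=; rewrite scale1r.
rewrite [X in _ ++ X]e -(clsP (rel_scaleD _ _ _)) addNr.
by apply: clsP; apply: rel_scale0.
Qed.

HB.instance Definition _ := GRing.isZmodule.Build tensor addA addC add0 addN.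

Let scaleA a b (x : tensor) :
  tensor_scale a (tensor_scale b x) = tensor_scale (a * b) x.
Proof.
rewrite -[x]treprK !scaleE -map_comp; congr tclass.
by apply: eq_map => p /=; rewrite scalerA.
Qed.

Let scale1 : left_id 1 tensor_scale.
Proof.
move=> x; rewrite -[x]treprK !scaleE; congr tclass.
by rewrite -[RHS]map_id; apply: eq_map => -[u v] /=; rewrite scale1r.
Qed.

Let scaleDr : right_distributive tensor_scale +%R.
Proof.
move=> a x y; rewrite -[x]treprK -[y]treprK.
by rewrite [X in tensor_scale _ X]addE !scaleE [RHS]addE map_cat.
Qed.

Let scaleDl (x : tensor) : {morph tensor_scale^~ x : a b / a + b}.
Proof.
move=> a b; rewrite -[x]treprK !scaleE [RHS]addE.
by apply: clsP; apply: rel_scaleD.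
Qed.

HB.instance Definition _ :=
  GRing.Zmodule_isLmodule.Build k tensor scaleA scale1 scaleDr scaleDl.

Definition pure (x : M) (y : N) : tensor := tclass [:: (x, y)].

Definition kbilinear (P : lmodType k) (f : M -> N -> P) : Prop :=
  (forall y, linear (f^~ y)) /\ (forall x, linear (f x)).

(* The k-linear map M ⊗ N -> P induced by f; meaningful only for a k-bilinear
   f (see [tlift_pure] and [tlift_linear]): the value is then independent of
   the chosen representative of t. *)
Definition tlift (P : lmodType k) (f : M -> N -> P) (t : tensor) : P :=
  \sum_(p <- trepr t) f p.1 p.2.

Section Lift.
Variables (P : lmodType k) (f : M -> N -> P).
Hypothesis f_bilin : kbilinear f.

Let fDl x x' y : f (x + x') y = f x y + f x' y.
Proof. by have := f_bilin.1 y 1 x x'; rewrite !scale1r. Qed.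
Let fDr x y y' : f x (y + y') = f x y + f x y'.
Proof. by have := f_bilin.2 x 1 y y'; rewrite !scale1r. Qed.
Let f0l y : f 0 y = 0.
Proof. by apply: (addrI (f 0 y)); rewrite -fDl !addr0. Qed.
Let f0r x : f x 0 = 0.
Proof. by apply: (addrI (f x 0)); rewrite -fDr !addr0. Qed.
Let fZl a x y : f (a *: x) y = a *: f x y.
Proof. by have := f_bilin.1 y a x 0; rewrite /= f0l !addr0. Qed.
Let fZr a x y : f x (a *: y) = a *: f x y.
Proof. by have := f_bilin.2 x a y 0; rewrite /= f0r !addr0. Qed.

Let sum_rel s t : tensor_rel s t ->
  \sum_(p <- s) f p.1 p.2 = \sum_(p <- t) f p.1 p.2.
Proof.
elim=> {s t} //=.
- by move=> s t u _ -> _ ->.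
- by move=> s s' t t' _ h1 _ h2; rewrite !big_cat /= h1 h2.
- by move=> s t; rewrite !big_cat /= addrC.
- by move=> x x' y; rewrite !big_cons big_nil !addr0 fDl.
- by move=> x y y'; rewrite !big_cons big_nil !addr0 fDr.
- by move=> y; rewrite big_seq1 big_nil f0l.
- by move=> a x y; rewrite !big_seq1 fZl fZr.
Qed.

Let tliftE s : tlift f (tclass s) = \sum_(p <- s) f p.1 p.2.
Proof. by apply: sum_rel; apply: repr_rel. Qed.

Lemma tlift_pure x y : tlift f (pure x y) = f x y.
Proof. by rewrite tliftE big_seq1. Qed.

Lemma tlift_linear : linear (tlift f).
Proof.
move=> a t u; rewrite -[t]treprK -[u]treprK.
rewrite [_ *: _]scaleE [_ + _]addE !tliftE big_cat big_map /=; congr (_ + _).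
by rewrite scaler_sumr; apply: eq_bigr => p _; rewrite fZl.
Qed.

End Lift.

Lemma tensor_ind (Q : tensor -> Prop) :
  Q 0 -> (forall x y, Q (pure x y)) -> (forall t u, Q t -> Q u -> Q (t + u)) ->
  forall t, Q t.
Proof.
move=> Q0 Qp QD t; rewrite -[t]treprK; elim: (trepr t) => // -[x y] s ih.
by rewrite -cat1s -addE; apply: QD ih; apply: Qp.
Qed.

Lemma pure_bilinear : kbilinear pure.
Proof.
split=> [y a x x'|x a y y'] /=.
  rewrite [a *: pure x y]scaleE [RHS]addE.
  by apply: clsP; apply: (TRaddl (a *: x)).
rewrite [a *: pure x y]scaleE [RHS]addE; apply: clsP.
apply: TRtrans (TRaddr _ _ _) _.
rewrite -cat1s; apply: TRcat (TRrefl [:: (x, y')]).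
exact: TRsym (TRscale _ _ _).
Qed.

End Tensor.

Notation "M ⊗ N" := (tensor M%type N%type) : type_scope.
Notation "x ⊗ y" := (pure x y) : ring_scope.

(* Sweedler sums: if t is the sum of the xi ⊗ yi, this is the sum of the
   F xi yi; F has to be bilinear in (x, y). *)
Notation "\tsum_ ( x , y <- t ) F" := (tlift (fun x y => F) t) : ring_scope.

(* [algType] of ssralg extends [nzRingType]; this structure also covers the
   zero algebra, hence the zero base ring. *)
HB.mixin Record isPzAlg (k : comPzRingType) A of GRing.Lmodule k A := {
  amul : A -> A -> A;
  aone : A;
  amul_bilinear : kbilinear amul;
  amulA : associative amul;
  amul1l : left_id aone amul;
  amul1r : right_id aone amul
}.
#[short(type="pzAlgType")]
HB.structure Definition PzAlg (k : comPzRingType) :=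
  {A of GRing.Lmodule k A & isPzAlg k A}.

Notation "x ∙ y" := (amul x y) : ring_scope.
Notation "'𝟙'" := aone : ring_scope.

(* The product of the algebra A ⊗ B. *)
Definition tmul (k : comPzRingType) (A B : pzAlgType k) (s t : A ⊗ B) : A ⊗ B :=
  \tsum_(a, b <- s) \tsum_(a', b' <- t) ((a ∙ a') ⊗ (b ∙ b')).

(* Iterated tensors are compared in U ⊗ (V ⊗ W). *)
HB.mixin Record isCoalgebra (k : comPzRingType) C of GRing.Lmodule k C := {
  comul : {linear C -> (C ⊗ C)%type};
  counit : {scalar C};
  comulA : forall c : C,
    \tsum_(x, y <- comul c) \tsum_(x1, x2 <- comul x) (x1 ⊗ (x2 ⊗ y)) =
    \tsum_(x, y <- comul c) (x ⊗ comul y);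
  counitl : forall c : C, \tsum_(x, y <- comul c) (counit x *: y) = c;
  counitr : forall c : C, \tsum_(x, y <- comul c) (counit y *: x) = c
}.
#[short(type="coalgType")]
HB.structure Definition Coalgebra (k : comPzRingType) :=
  {C of GRing.Lmodule k C & isCoalgebra k C}.

HB.mixin Record isHopfAlg (k : comPzRingType) H
    of PzAlg k H & Coalgebra k H := {
  comulM : forall x y : H, comul (x ∙ y) = tmul (comul x) (comul y);
  comul1 : comul (𝟙 : H) = 𝟙 ⊗ 𝟙;
  counitM : forall x y : H, counit (x ∙ y) = counit x * counit y;
  counit1 : counit (𝟙 : H) = 1;
  antipode : {linear H -> H};
  antipodel : forall h : H,
    \tsum_(x, y <- comul h) (antipode x ∙ y) = counit h *: 𝟙;
  antipoder : forall h : H,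
    \tsum_(x, y <- comul h) (x ∙ antipode y) = counit h *: 𝟙
}.
#[short(type="hopfAlgType")]
HB.structure Definition HopfAlg (k : comPzRingType) :=
  {H of PzAlg k H & Coalgebra k H & isHopfAlg k H}.

Record is_right_module (k : comPzRingType) (A : pzAlgType k) (M : lmodType k)
    (act : M -> A -> M) : Prop := {
  act_bilinear : kbilinear act;
  actA : forall m a b, act m (a ∙ b) = act (act m a) b;
  act1 : forall m, act m 𝟙 = m
}.

Record is_left_comodule (k : comPzRingType) (C : coalgType k) (M : lmodType k)
    (coact : M -> C ⊗ M) : Prop := {
  coact_linear : linear coact;
  coactA : forall m,
    \tsum_(c, m0 <- coact m) \tsum_(c1, c2 <- comul c) (c1 ⊗ (c2 ⊗ m0)) =
    \tsum_(c, m0 <- coact m) (c ⊗ coact m0);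
  coact_counit : forall m, \tsum_(c, m0 <- coact m) (counit c *: m0) = m
}.

HB.mixin Record isComodAlg (k : comPzRingType) (H : hopfAlgType k) A
    of PzAlg k A := {
  acoact : A -> H ⊗ A;
  acoact_comodule : is_left_comodule acoact;
  acoactM : forall a b : A, acoact (a ∙ b) = tmul (acoact a) (acoact b);
  acoact1 : acoact (𝟙 : A) = 𝟙 ⊗ 𝟙
}.
#[short(type="comodAlgType")]
HB.structure Definition ComodAlg (k : comPzRingType) (H : hopfAlgType k) :=
  {A of PzAlg k A & isComodAlg k H A}.

HB.mixin Record isModCoalg (k : comPzRingType) (H : hopfAlgType k) C
    of Coalgebra k C := {
  cact : C -> H -> C;
  cact_module : is_right_module cact;
  cact_comul : forall (c : C) (h : H), comul (cact c h) =
    \tsum_(c1, c2 <- comul c) \tsum_(h1, h2 <- comul h)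
      (cact c1 h1 ⊗ cact c2 h2);
  cact_counit : forall (c : C) (h : H),
    counit (cact c h) = counit c * counit h
}.
#[short(type="modCoalgType")]
HB.structure Definition ModCoalg (k : comPzRingType) (H : hopfAlgType k) :=
  {C of Coalgebra k C & isModCoalg k H C}.

Section TensorTheory.
Context {k : comPzRingType}.
Implicit Types M N P Q U V W : lmodType k.

Lemma eq_tlift M N P (f g : M -> N -> P) t :
  (forall x y, f x y = g x y) -> tlift f t = tlift g t.
Proof. by move=> e; apply: eq_bigr => p _. Qed.

Lemma lin0 U V (f : U -> V) : linear f -> f 0 = 0.
Proof.
move=> lf; have := lf 1 0 0; rewrite !scale1r addr0 => e.
by apply: (addrI (f 0)); rewrite -e addr0.
Qed.

Lemma linD U V (f : U -> V) x y : linear f -> f (x + y) = f x + f y.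
Proof. by move=> lf; have := lf 1 x y; rewrite !scale1r. Qed.

Lemma linZ U V (f : U -> V) a x : linear f -> f (a *: x) = a *: f x.
Proof. by move=> lf; rewrite -[a *: x]addr0 lf lin0 ?addr0. Qed.

Lemma lin_tlift M N P Q (g : P -> Q) (f : M -> N -> P) t :
  linear g -> g (tlift f t) = tlift (fun x y => g (f x y)) t.
Proof.
move=> lg; rewrite /tlift; elim: (trepr t) => [|p s ih].
  by rewrite !big_nil lin0.
by rewrite !big_cons linD // ih.
Qed.

Lemma exchange_tlift M N U V P (f : M -> N -> U -> V -> P) s t :
  \tsum_(x, y <- s) \tsum_(u, v <- t) (f x y u v) =
  \tsum_(u, v <- t) \tsum_(x, y <- s) (f x y u v).
Proof. exact: exchange_big. Qed.

Lemma tensor_eq M N P (f g : M ⊗ N -> P) : linear f -> linear g ->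
  (forall x y, f (x ⊗ y) = g (x ⊗ y)) -> forall t, f t = g t.
Proof.
move=> lf lg e; apply: tensor_ind => // [|t u et eu]; first by rewrite !lin0.
by rewrite !linD // et eu.
Qed.

Lemma lin_id U : linear (fun x : U => x). Proof. by []. Qed.

Lemma lin_comp U V W (f : V -> W) (g : U -> V) :
  linear f -> linear g -> linear (fun x => f (g x)).
Proof. by move=> lf lg a x y; rewrite lg lf. Qed.

Lemma lin_tlift_fun U M N P (F : U -> M -> N -> P) t :
  (forall x y, linear (fun u => F u x y)) -> linear (fun u => tlift (F u) t).
Proof.
move=> lF a u v; rewrite /tlift scaler_sumr -big_split /=.
by apply: eq_bigr => p _; rewrite lF.
Qed.

Lemma lin_tlift_arg U M N P (F : M -> N -> P) (g : U -> M ⊗ N) :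
  kbilinear F -> linear g -> linear (fun u => tlift F (g u)).
Proof. by move=> bF; apply: lin_comp; apply: tlift_linear. Qed.

Lemma lin_bil1 U M N P (F : M -> N -> P) (g : U -> M) y :
  kbilinear F -> linear g -> linear (fun u => F (g u) y).
Proof. by move=> bF; apply: (lin_comp (bF.1 y)). Qed.

Lemma lin_bil2 U M N P (F : M -> N -> P) (g : U -> N) x :
  kbilinear F -> linear g -> linear (fun u => F x (g u)).
Proof. by move=> bF; apply: (lin_comp (bF.2 x)). Qed.

Lemma lin_scale2 U M (a : k) (g : U -> M) : linear g -> linear (fun u => a *: g u).
Proof. by move=> lg b u v; rewrite lg scalerDr !scalerA mulrC. Qed.

Lemma tlift3_pure U V W P (F : U -> V -> W -> P) x y z :
  (forall u, kbilinear (F u)) -> (forall v w, linear (fun u => F u v w)) ->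
  \tsum_(u, s <- x ⊗ (y ⊗ z)) \tsum_(v, w <- s) (F u v w) = F x y z.
Proof.
move=> b l; rewrite tlift_pure ?tlift_pure //.
by split=> [s|u]; [exact: lin_tlift_fun | exact: tlift_linear].
Qed.

Lemma tlift3_linear U V W P (F : U -> V -> W -> P) :
  (forall u, kbilinear (F u)) -> (forall v w, linear (fun u => F u v w)) ->
  linear (fun t => \tsum_(u, s <- t) \tsum_(v, w <- s) (F u v w)).
Proof.
move=> b l; apply: lin_tlift_arg => //.
by split=> [s|u]; [exact: lin_tlift_fun | exact: tlift_linear].
Qed.

End TensorTheory.

Ltac klin := repeat first
  [ assumption | exact: lin_id | exact: pure_bilinear | exact: amul_bilinear
  | exact: linearP
  | match goal with
    | |- kbilinear _ => split=> ? /=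
    | |- linear (tlift _) => apply: tlift_linear
    | |- linear (pure ?x) => exact: ((@pure_bilinear _ _ _).2 x)
    | |- linear (fun u => tlift ?F (@?g u)) =>
        apply: (@lin_tlift_arg _ _ _ _ _ F g)
    | |- linear (fun u => tlift (@?F u) ?t) =>
        apply: (@lin_tlift_fun _ _ _ _ _ F t) => ? ? /=
    | |- linear (fun u => pure (@?g u) ?y) =>
        apply: (lin_bil1 (g := g) y (@pure_bilinear _ _ _))
    | |- linear (fun u => pure ?x (@?g u)) =>
        apply: (lin_bil2 (g := g) x (@pure_bilinear _ _ _))
    | |- linear (fun u => amul (@?g u) ?y) =>
        apply: (lin_bil1 (g := g) y (@amul_bilinear _ _))
    | |- linear (fun u => amul ?x (@?g u)) =>
        apply: (lin_bil2 (g := g) x (@amul_bilinear _ _))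
    | |- linear (fun u => ?a *: (@?g u)) => apply: (@lin_scale2 _ _ _ a g)
    | b : kbilinear ?f |- linear (fun u => ?f (@?g u) ?y) =>
        apply: (lin_bil1 (g := g) y b)
    | b : kbilinear ?f |- linear (fun u => ?f ?x (@?g u)) =>
        apply: (lin_bil2 (g := g) x b)
    | l : linear ?f |- linear (fun u => ?f (@?g u)) =>
        apply: (@lin_comp _ _ _ _ f g l)
    end ].

Section TensorObjects.
Context {k : comPzRingType}.
Implicit Type V : lmodType k.

Lemma counit_linear (C : coalgType k) (M : lmodType k) (y : M) :
  linear (fun c : C => counit c *: y).
Proof. by move=> a b c; rewrite linearP scalerDl scalerA. Qed.

Lemma comul_comodule (C : coalgType k) : is_left_comodule (comul : C -> C ⊗ C).
Proof. by split; [exact: linearP | exact: comulA | exact: counitl]. Qed.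

Lemma counit_bil (C : coalgType k) (M : lmodType k) :
  kbilinear (fun (c : C) (m : M) => counit c *: m).
Proof. by split=> [m|c]; [exact: counit_linear | apply: lin_scale2; klin]. Qed.

Section Coact.
Variables (C : coalgType k) (X V : lmodType k) (rho : X -> C ⊗ X).

Definition tens_coact (t : X ⊗ V) : C ⊗ (X ⊗ V) :=
  \tsum_(x, v <- t) \tsum_(c, x0 <- rho x) (c ⊗ (x0 ⊗ v)).

Hypothesis rhoP : is_left_comodule rho.
Let rho_lin := coact_linear rhoP.

Lemma tens_coact_linear : linear tens_coact.
Proof. rewrite /tens_coact; have := rho_lin => ?; klin. Qed.

Lemma tens_coact_pure x v :
  tens_coact (x ⊗ v) = \tsum_(c, x0 <- rho x) (c ⊗ (x0 ⊗ v)).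
Proof. rewrite /tens_coact tlift_pure //; have := rho_lin => ?; klin. Qed.

Lemma tens_coact_comodule : is_left_comodule tens_coact.
Proof.
have rl := rho_lin; have tl := tens_coact_linear.
have cl : linear (comul : C -> C ⊗ C) by exact: linearP.
split=> //.
- refine (tensor_eq (M := X) (N := V) _ _ _) => /=; [by klin | by klin |] => x v.
  rewrite tens_coact_pure.
  rewrite [LHS]lin_tlift; last by klin.
  rewrite [RHS]lin_tlift; last by klin.
  pose F t := \tsum_(a : C, s <- t) \tsum_(b : C, x0 : X <- s) (a ⊗ (b ⊗ (x0 ⊗ v))).
  have Flin : linear F by rewrite /F; klin.
  have Fp a b x0 : F (a ⊗ (b ⊗ x0)) = a ⊗ (b ⊗ (x0 ⊗ v)).
    by apply: (tlift3_pure (F := fun a b x0 => a ⊗ (b ⊗ (x0 ⊗ v)))) => *; klin.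
  transitivity (F (\tsum_(c, x0 <- rho x) \tsum_(c1, c2 <- comul c)
                     (c1 ⊗ (c2 ⊗ x0)))).
    rewrite (lin_tlift _ _ Flin); apply: eq_tlift => c x0.
    rewrite tlift_pure; last by klin.
    by rewrite (lin_tlift _ _ Flin); apply: eq_tlift => c1 c2; rewrite Fp.
  rewrite (coactA rhoP) (lin_tlift _ _ Flin); apply: eq_tlift => c x0.
  rewrite tlift_pure; last by klin.
  rewrite tens_coact_pure /F tlift_pure; last by klin.
  by rewrite (lin_tlift (g := pure c)) //; klin.
- refine (tensor_eq (M := X) (N := V) _ _ _) => /=; [|by klin|] => [|x v].
    by apply: lin_tlift_arg tl; apply: counit_bil.
  rewrite tens_coact_pure lin_tlift; last first.
    by apply: tlift_linear; apply: counit_bil.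
  rewrite -[in RHS](coact_counit rhoP x).
  rewrite [RHS](lin_tlift (g := fun x => x ⊗ v)); last by klin.
  apply: eq_tlift => c x0; rewrite tlift_pure; last exact: counit_bil.
  exact/esym/(linZ (f := fun x => x ⊗ v))/(@pure_bilinear _ X V).1.
Qed.

End Coact.
End TensorObjects.

Section DoiKoppinen.
Context {k : comPzRingType} {H : hopfAlgType k}.
Variables (A : comodAlgType H) (C : modCoalgType H).

(* The objects of ^C M(H)_A. *)
Record dkMod := DKMod {
  dk_mod :> lmodType k;
  dk_act : dk_mod -> A -> dk_mod;
  dk_coact : dk_mod -> C ⊗ dk_mod;
  dk_act_module : is_right_module dk_act;
  dk_coact_comodule : is_left_comodule dk_coact;
  dk_compat : forall m a, dk_coact (dk_act m a) =
    \tsum_(c, m0 <- dk_coact m) \tsum_(h, a0 <- acoact a)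
      (cact c h ⊗ dk_act m0 a0)
}.

Record is_dk_hom (M N : dkMod) (f : M -> N) : Prop := {
  dk_hom_linear : linear f;
  dk_hom_act : forall m a, f (dk_act m a) = dk_act (f m) a;
  dk_hom_coact : forall m,
    dk_coact (f m) = \tsum_(c, m0 <- dk_coact m) (c ⊗ f m0)
}.

Definition k_split_epi (M N : dkMod) (f : M -> N) : Prop :=
  is_dk_hom f /\ exists s : {linear N -> M}, cancel s f.

(* Hom(G, -) is faithful. *)
Definition is_generator (G : dkMod) : Prop :=
  forall (M N : dkMod) (u v : M -> N), is_dk_hom u -> is_dk_hom v ->
  (forall g : G -> M, is_dk_hom g -> forall x, u (g x) = v (g x)) ->
  forall m, u m = v m.

(* A family γ of k-linear maps C -> A that depends k-linearly on its index is
   a k-linear map C -> Hom(C, A). *)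
Record is_integral (γ : C -> {linear C -> A}) : Prop := {
  integral_linear : forall d, linear (fun c => γ c d);
  integralP : forall c d : C,
    \tsum_(c1, c2 <- comul c) (c1 ⊗ γ c2 d) =
    \tsum_(d1, d2 <- comul d) \tsum_(h, a0 <- acoact (γ c d1)) (cact d2 h ⊗ a0)
}.

Definition is_total (γ : C -> {linear C -> A}) : Prop :=
  forall c : C, \tsum_(c1, c2 <- comul c) (γ c1 c2) = counit c *: 𝟙.

Let cbS := act_bilinear (@cact_module k H C).
Let alS := coact_linear (@acoact_comodule k H A).
Let mlS : linear (comul : C -> C ⊗ C) := linearP _.

Section TensorDK.
Variables (X : dkMod) (V : lmodType k).

Definition dk_tensor_act (t : X ⊗ V) (b : A) : X ⊗ V :=
  \tsum_(x, v <- t) (dk_act x b ⊗ v).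

Let xbS := act_bilinear (dk_act_module X).
Let xlS := coact_linear (dk_coact_comodule X).

Lemma dk_tensor_act_bilinear : kbilinear dk_tensor_act.
Proof. rewrite /dk_tensor_act; have ? := xbS; klin. Qed.

Lemma dk_tensor_act_pure x v b : dk_tensor_act (x ⊗ v) b = dk_act x b ⊗ v.
Proof. rewrite /dk_tensor_act tlift_pure //; have ? := xbS; klin. Qed.

Lemma dk_tensor_module : is_right_module dk_tensor_act.
Proof.
have [bl _] := dk_tensor_act_bilinear.
split=> [|m a b|m]; first exact: dk_tensor_act_bilinear; move: m.
- refine (tensor_eq (M := X) (N := V) _ _ _) => /=; [exact: bl| |].
    exact: (lin_comp (bl b) (bl a)).
  by move=> x v; rewrite !dk_tensor_act_pure (actA (dk_act_module X)).
- refine (tensor_eq (M := X) (N := V) _ _ _) => /=; [exact: bl|by klin|].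
  by move=> x v; rewrite dk_tensor_act_pure (act1 (dk_act_module X)).
Qed.

Lemma dk_tensor_compat t a : tens_coact (@dk_coact X) (dk_tensor_act t a) =
  \tsum_(c, t0 <- tens_coact (@dk_coact X) t) \tsum_(h, a0 <- acoact a)
    (cact c h ⊗ dk_tensor_act t0 a0).
Proof.
have tb := dk_tensor_act_bilinear; have [bl _] := tb.
have tl := tens_coact_linear (V := V) (dk_coact_comodule X).
have cb := cbS; have xb := xbS; have xl := xlS.
move: t; refine (tensor_eq (M := X) (N := V) _ _ _) => /=; [by klin|by klin|].
move=> x v; rewrite dk_tensor_act_pure !tens_coact_pure; try exact: dk_coact_comodule.
rewrite dk_compat.
rewrite (lin_tlift (g := tlift _)); last by klin.
rewrite [RHS](lin_tlift (g := tlift _)); last by klin.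
apply: eq_tlift => c x0; rewrite [RHS]tlift_pure; last by klin.
rewrite (lin_tlift (g := tlift _)); last by klin.
apply: eq_tlift => h a0; rewrite dk_tensor_act_pure tlift_pure //; klin.
Qed.

(* X ⊗ V with the structures of X. *)
Definition dk_tensor : dkMod := DKMod dk_tensor_module
  (tens_coact_comodule V (dk_coact_comodule X)) dk_tensor_compat.

End TensorDK.

Definition dkCA_act (t : C ⊗ A) (b : A) : C ⊗ A :=
  \tsum_(c, a <- t) \tsum_(h, b0 <- acoact b) (cact c h ⊗ (a ∙ b0)).

Lemma dkCA_act_bilinear : kbilinear dkCA_act.
Proof. rewrite /dkCA_act; have ? := cbS; have ? := alS; klin. Qed.

Lemma dkCA_act_pure c a b : dkCA_act (c ⊗ a) b =
  \tsum_(h, b0 <- acoact b) (cact c h ⊗ (a ∙ b0)).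
Proof. rewrite /dkCA_act tlift_pure //; have ? := cbS; have ? := alS; klin. Qed.

Lemma dkCA_module : is_right_module dkCA_act.
Proof.
have [bl br] := dkCA_act_bilinear; have cb := cbS; have al := alS.
split=> [|m a b|m]; first exact: dkCA_act_bilinear; move: m.
- refine (tensor_eq (M := C) (N := A) _ _ _) => /=; [exact: bl| |].
    exact: (lin_comp (bl b) (bl a)).
  move=> c x; rewrite !dkCA_act_pure acoactM /tmul.
  rewrite (lin_tlift (g := tlift _)); last by klin.
  rewrite (lin_tlift (g := fun t => dkCA_act t b)); last exact: bl.
  apply: eq_tlift => h a0; rewrite dkCA_act_pure.
  rewrite (lin_tlift (g := tlift _)); last by klin.
  apply: eq_tlift => h' b0; rewrite tlift_pure; last by klin.
  by rewrite (actA (@cact_module k H C)) amulA.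
- refine (tensor_eq (M := C) (N := A) _ _ _) => /=; [exact: bl|by klin|].
  move=> c x; rewrite dkCA_act_pure acoact1 tlift_pure; last by klin.
  by rewrite (act1 (@cact_module k H C)) amul1r.
Qed.

Lemma dkCA_compat t b : tens_coact comul (dkCA_act t b) =
  \tsum_(c, t0 <- tens_coact (comul : C -> _) t) \tsum_(h, b0 <- acoact b)
    (cact c h ⊗ dkCA_act t0 b0).
Proof.
have tb := dkCA_act_bilinear; have [bl _] := tb.
have tl := tens_coact_linear (V := A) (comul_comodule C).
have cb := cbS; have al := alS; have ml := mlS.
have hl : linear (comul : H -> H ⊗ H) by exact: linearP.
move: t; refine (tensor_eq (M := C) (N := A) _ _ _) => /=; [by klin|by klin|].
move=> c a; rewrite dkCA_act_pure tens_coact_pure; last exact: comul_comodule.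
rewrite (lin_tlift (g := tens_coact _)) //.
rewrite [RHS](lin_tlift (g := tlift _)); last by klin.
under [RHS]eq_tlift => c1 c2.
  rewrite tlift_pure; last by klin.
  under eq_tlift => h b0 do rewrite dkCA_act_pure.
  over.
pose G (c1 c2 : C) (t : H ⊗ (H ⊗ A)) := \tsum_(h1, s <- t) \tsum_(h2, b0 <- s)
  (cact c1 h1 ⊗ (cact c2 h2 ⊗ (a ∙ b0))).
have Gl c1 c2 : linear (G c1 c2) by rewrite /G; klin.
have Gp c1 c2 h1 h2 b0 : G c1 c2 (h1 ⊗ (h2 ⊗ b0)) =
    cact c1 h1 ⊗ (cact c2 h2 ⊗ (a ∙ b0)).
  apply: (tlift3_pure (F := fun h1 h2 b0 =>
    cact c1 h1 ⊗ (cact c2 h2 ⊗ (a ∙ b0)))) => *; klin.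
transitivity (\tsum_(c1, c2 <- comul c) (G c1 c2
  (\tsum_(h, b0 <- acoact b) \tsum_(h1, h2 <- comul h) (h1 ⊗ (h2 ⊗ b0))))).
  under [RHS]eq_tlift => c1 c2.
    rewrite (lin_tlift _ _ (Gl c1 c2)).
    under eq_tlift => h b0.
      rewrite (lin_tlift _ _ (Gl c1 c2)).
      under eq_tlift => h1 h2 do rewrite Gp.
      over.
    over.
  rewrite exchange_tlift; apply: eq_tlift => h b0.
  rewrite tens_coact_pure; last exact: comul_comodule.
  rewrite cact_comul (lin_tlift (g := tlift _)); last by klin.
  apply: eq_tlift => c1 c2; rewrite (lin_tlift (g := tlift _)); last by klin.
  by apply: eq_tlift => h1 h2; rewrite tlift_pure //; klin.
rewrite (coactA (@acoact_comodule k H A)); apply: eq_tlift => c1 c2.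
rewrite (lin_tlift _ _ (Gl c1 c2)); apply: eq_tlift => h b0.
rewrite /G tlift_pure; last by klin.
by rewrite [RHS](lin_tlift (g := pure _)) //; klin.
Qed.

(* C ⊗ A; its coaction is induced by the comultiplication of C. *)
Definition dkCA : dkMod := DKMod dkCA_module
  (tens_coact_comodule A (comul_comodule C)) dkCA_compat.

End DoiKoppinen.

(* Main.v *)
(* The A-linearity of f follows from S(ab) = S(b) S(a), which turns
   c b_<-2> S(a_<-1> b_<-1>) into c S(a_<-1>).  For its C-colinearity, the
   integral identity moves the H-coaction of γ(..)(m_<-1>) to the coproduct of
   c S(a_<-1>), and Δ(S(h)) = S(h_2) ⊗ S(h_1) again leaves an antipode
   cancellation.  Totality of γ makes m ↦ m_<-1> ⊗ 1 ⊗ m_<0> a section of f.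
   Every M is thus covered by the morphisms f(- ⊗ m) from C ⊗ A, so C ⊗ A is a
   generator.  Both properties of S come from the uniqueness of inverses for
   the convolution product. *)
Require Import Defs.
From HB Require Import structures.
From mathcomp Require Import all_boot all_algebra.
Set Implicit Arguments.
Unset Strict Implicit.
Unset Printing Implicit Defensive.
Local Open Scope ring_scope.
Import GRing.Theory.

Ltac slin := intros; klin.

(** * Calculus of Sweedler sums: nesting, coassociativity and counits *)

Section Sweedler.
Context {k : comPzRingType}.
Implicit Types M N P Q U V W : lmodType k.

Lemma tlift_tlift M N P Q U (F : M -> N -> P) (G : U -> Q -> M ⊗ N) t :
  kbilinear F ->
  \tsum_(x, y <- tlift G t) (F x y) =
  \tsum_(u, v <- t) \tsum_(x, y <- G u v) (F x y).
Proof. by move=> bF; apply: (lin_tlift (g := tlift F)); apply: tlift_linear. Qed.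

Lemma tlift_tlift_pure M N P Q U (F : M -> N -> P) (G : U -> Q -> M)
    (G' : U -> Q -> N) t : kbilinear F ->
  \tsum_(x, y <- \tsum_(u, v <- t) (G u v ⊗ G' u v)) (F x y) =
  \tsum_(u, v <- t) (F (G u v) (G' u v)).
Proof.
by move=> bF; rewrite tlift_tlift //; apply: eq_tlift => u v; rewrite tlift_pure.
Qed.

Section Comodule.
Variables (C : coalgType k) (M : lmodType k) (rho : M -> C ⊗ M).
Hypothesis rhoP : is_left_comodule rho.

(** A trilinear [F] induces a linear map on [C ⊗ (C ⊗ M)]; applying it to both sides of [coactA]
    gives coassociativity in the form used below to regroup Sweedler indices. *)
Lemma coassoc_tlift P (F : C -> C -> M -> P) m :
  (forall u, kbilinear (F u)) -> (forall v w, linear (fun u => F u v w)) ->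
  \tsum_(c, m0 <- rho m) \tsum_(c1, c2 <- comul c) (F c1 c2 m0) =
  \tsum_(c, m0 <- rho m) \tsum_(c', m00 <- rho m0) (F c c' m00).
Proof.
move=> b l; pose G t := \tsum_(u, s <- t) \tsum_(v, w <- s) (F u v w).
have Gl : linear G by exact: tlift3_linear.
have Gp u v w : G (u ⊗ (v ⊗ w)) = F u v w by exact: tlift3_pure.
have := congr1 G (coactA rhoP m); rewrite !(lin_tlift _ _ Gl) => e.
transitivity (\tsum_(c, m0 <- rho m) G
   (\tsum_(c1, c2 <- comul c) (c1 ⊗ (c2 ⊗ m0)))).
  apply: eq_tlift => c m0; rewrite (lin_tlift _ _ Gl).
  by apply: eq_tlift => c1 c2; rewrite Gp.
rewrite e; apply: eq_tlift => c m0; rewrite /G tlift_pure //.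
by split=> [s|u]; [exact: lin_tlift_fun | exact: tlift_linear].
Qed.

Lemma counit_tlift P (G : M -> P) m : linear G ->
  \tsum_(c, m0 <- rho m) (counit c *: G m0) = G m.
Proof.
move=> lG; rewrite -[in RHS](coact_counit rhoP m) (lin_tlift _ _ lG).
by apply: eq_tlift => c m0; rewrite (linZ _ _ lG).
Qed.

End Comodule.

Lemma comul_coassoc_tlift (C : coalgType k) P (F : C -> C -> C -> P) c :
  (forall u, kbilinear (F u)) -> (forall v w, linear (fun u => F u v w)) ->
  \tsum_(x, y <- comul c) \tsum_(x1, x2 <- comul x) (F x1 x2 y) =
  \tsum_(x, y <- comul c) \tsum_(y1, y2 <- comul y) (F x y1 y2).
Proof. exact: (coassoc_tlift (comul_comodule C)). Qed.

Lemma counitl_tlift (C : coalgType k) P (G : C -> P) c : linear G ->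
  \tsum_(x, y <- comul c) (counit x *: G y) = G c.
Proof. exact: (counit_tlift (comul_comodule C)). Qed.

Lemma counitr_tlift (C : coalgType k) P (G : C -> P) c : linear G ->
  \tsum_(x, y <- comul c) (counit y *: G x) = G c.
Proof.
move=> lG; rewrite -[in RHS](counitr c) (lin_tlift _ _ lG).
by apply: eq_tlift => x y; rewrite (linZ _ _ lG).
Qed.

Lemma amulZl (B : pzAlgType k) a (x y : B) : (a *: x) ∙ y = a *: (x ∙ y).
Proof. exact: (linZ _ _ ((@amul_bilinear k B).1 y)). Qed.

Lemma amulZr (B : pzAlgType k) a (x y : B) : x ∙ (a *: y) = a *: (x ∙ y).
Proof. exact: (linZ _ _ ((@amul_bilinear k B).2 x)). Qed.

Lemma tlift_amull (B : pzAlgType k) M N (F : M -> N -> B) t y :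
  tlift F t ∙ y = \tsum_(u, v <- t) (F u v ∙ y).
Proof. exact: (lin_tlift _ _ ((@amul_bilinear k B).1 y)). Qed.

Lemma tlift_amulr (B : pzAlgType k) M N (F : M -> N -> B) t x :
  x ∙ tlift F t = \tsum_(u, v <- t) (x ∙ F u v).
Proof. exact: (lin_tlift _ _ ((@amul_bilinear k B).2 x)). Qed.

Lemma tlift_scaler M N P (F : M -> N -> P) t (a : k) :
  a *: tlift F t = \tsum_(u, v <- t) (a *: F u v).
Proof. by apply: (lin_tlift (g := fun x => a *: x)); klin. Qed.

End Sweedler.

(** * The tensor product of two algebras *)

Section TensorAlgebra.
Context {k : comPzRingType}.
Variables A B : pzAlgType k.

Lemma tmul_bilinear : kbilinear (@tmul k A B).
Proof. by rewrite /tmul; klin. Qed.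

Lemma tmul_pure (a a' : A) (b b' : B) :
  tmul (a ⊗ b) (a' ⊗ b') = (a ∙ a') ⊗ (b ∙ b').
Proof. by rewrite /tmul tlift_pure ?tlift_pure //; klin. Qed.

Lemma tmulA : associative (@tmul k A B).
Proof.
have [bl br] := tmul_bilinear.
move=> x y z; move: x; apply: tensor_eq => [||a b].
- exact: bl.
- exact: lin_comp (bl z) (bl y).
move: y; apply: tensor_eq => [||a' b'].
- exact: lin_comp (br _) (bl z).
- exact: lin_comp (bl z) (br _).
move: z; apply: tensor_eq => [||a'' b''].
- exact: lin_comp (br _) (br _).
- exact: br.
by rewrite !tmul_pure !amulA.
Qed.

Lemma tmul1l : left_id (𝟙 ⊗ 𝟙) (@tmul k A B).
Proof.
apply: tensor_eq => [||a b]; [exact: tmul_bilinear.2 | by klin |].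
by rewrite tmul_pure !amul1l.
Qed.

Lemma tmul1r : right_id (𝟙 ⊗ 𝟙) (@tmul k A B).
Proof.
apply: tensor_eq => [||a b]; [exact: tmul_bilinear.1 | by klin |].
by rewrite tmul_pure !amul1r.
Qed.

(** Makes uniqueness of convolution inverses available for maps into [H ⊗ H], as needed for the
    coproduct of an antipode. *)
HB.instance Definition _ :=
  isPzAlg.Build k (tensor A B) tmul_bilinear tmulA tmul1l tmul1r.

End TensorAlgebra.

(** * Uniqueness of convolution inverses *)

Section Convolution.
Context {k : comPzRingType}.

(** Both [L] and [R] equal the triple convolution of [L], [M] and [R], bracketed in the two ways
    that coassociativity identifies. *)
Lemma conv_inverse_uniq (D : coalgType k) (B : pzAlgType k) (L M R : D -> B) :
  linear L -> linear M -> linear R ->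
  (forall d, \tsum_(x, y <- comul d) (L x ∙ M y) = counit d *: 𝟙) ->
  (forall d, \tsum_(x, y <- comul d) (M x ∙ R y) = counit d *: 𝟙) ->
  L =1 R.
Proof.
move=> lL lM lR LM MR d.
transitivity (\tsum_(x, y <- comul d) \tsum_(y1, y2 <- comul y)
    (L x ∙ (M y1 ∙ R y2))).
  (* [L d] is expanded by the right counit, whose factor then becomes the convolution of [M] and [R]
     at [y]. *)
  rewrite -{1}(counitr_tlift (G := L)) //; apply: eq_tlift => x y.
  by rewrite -tlift_amulr MR amulZr amul1r.
rewrite -(comul_coassoc_tlift (F := fun x y z => L x ∙ (M y ∙ R z))); try by slin.
rewrite -[RHS](counitl_tlift (G := R)) //; apply: eq_tlift => x y.
rewrite -[in RHS](amul1l (R y)) -amulZl -LM tlift_amull.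
by apply: eq_tlift => u v; rewrite amulA.
Qed.

(** The same argument for maps on [D ⊗ E], written with functions of two variables so that no
    coalgebra structure on [D ⊗ E] has to be built. *)
Lemma conv2_inverse_uniq (D E : coalgType k) (B : pzAlgType k)
    (L M R : D -> E -> B) :
  kbilinear L -> kbilinear M -> kbilinear R ->
  (forall d e, \tsum_(x, y <- comul d) \tsum_(z, w <- comul e)
     (L x z ∙ M y w) = counit d *: (counit e *: 𝟙)) ->
  (forall d e, \tsum_(x, y <- comul d) \tsum_(z, w <- comul e)
     (M x z ∙ R y w) = counit d *: (counit e *: 𝟙)) ->
  forall d e, L d e = R d e.
Proof.
move=> lL lM lR LM MR d e.
transitivity (\tsum_(x, y <- comul d) \tsum_(y1, y2 <- comul y)
   \tsum_(z, w <- comul e) \tsum_(w1, w2 <- comul w)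
    (L x z ∙ (M y1 w1 ∙ R y2 w2))).
  rewrite -{1}(counitr_tlift (G := L ^~ e)); last exact: lL.1.
  apply: eq_tlift => x y.
  rewrite exchange_tlift.
  rewrite -{1}(counitr_tlift (G := L x)) ?tlift_scaler; last exact: lL.2.
  apply: eq_tlift => z w.
  under [RHS]eq_tlift => y1 y2 do rewrite -tlift_amulr.
  by rewrite -tlift_amulr MR !amulZr amul1r.
have lD : linear (comul : D -> _) by exact: linearP.
have lE : linear (comul : E -> _) by exact: linearP.
rewrite -(comul_coassoc_tlift (F := fun x y1 y2 =>
   \tsum_(z, w <- comul e) \tsum_(w1, w2 <- comul w)
    (L x z ∙ (M y1 w1 ∙ R y2 w2)))); try by slin.
rewrite -[RHS](counitl_tlift (G := R ^~ e)); last exact: lR.1.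
apply: eq_tlift => x y.
(* The [D] indices are already regrouped; coassociativity of [E] is now applied beneath them. *)
under [LHS]eq_tlift => x1 x2.
  rewrite -(comul_coassoc_tlift (F := fun z w1 w2 => L x1 z ∙ (M x2 w1 ∙ R y w2)));
    try by slin.
  over.
rewrite exchange_tlift.
rewrite -(counitl_tlift (G := R y)) ?tlift_scaler; last exact: lR.2.
apply: eq_tlift => z w.
rewrite -[in RHS](amul1l (R y w)) -!amulZl -LM tlift_amull.
apply: eq_tlift => u v; rewrite tlift_amull.
by apply: eq_tlift => u' v'; rewrite amulA.
Qed.

End Convolution.

(** * The antipode reverses products and coproducts *)

Section Antipode.
Context {k : comPzRingType} (H : hopfAlgType k).
Implicit Types x y h : H.

Let lS : linear (antipode : H -> H) := linearP _.
Let lD : linear (comul : H -> _) := linearP _.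

Lemma comulM_tlift (P : lmodType k) (F : H -> H -> P) x y : kbilinear F ->
  \tsum_(u, v <- comul (x ∙ y)) (F u v) =
  \tsum_(x1, x2 <- comul x) \tsum_(y1, y2 <- comul y) (F (x1 ∙ y1) (x2 ∙ y2)).
Proof.
move=> bF; rewrite comulM /tmul tlift_tlift //; apply: eq_tlift => x1 x2.
exact: tlift_tlift_pure.
Qed.

Lemma antipode1 : antipode (𝟙 : H) = 𝟙.
Proof.
have := antipodel (𝟙 : H); rewrite comul1 counit1 scale1r tlift_pure ?amul1r //.
have ? := lS; klin.
Qed.

(** The left side is a left convolution inverse of the multiplication of [H], because [comul] and
    [counit] are multiplicative; the right side is a right inverse. *)
Lemma antipodeM x y : antipode (x ∙ y) = antipode y ∙ antipode x.
Proof.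
have ? := lS; have ? := lD.
apply: (conv2_inverse_uniq (L := fun x y => antipode (x ∙ y)) (M := amul)
  (R := fun x y => antipode y ∙ antipode x)); try by slin.
- move=> d e; rewrite scalerA -counitM -antipodel comulM_tlift //; klin.
- move=> d e; rewrite -[counit d *: _](linZ (f := fun t => counit e *: t)); last by klin.
  rewrite -antipoder tlift_scaler.
  (* In [x1 y1 S(y2) S(x2)] the inner product [y1 S(y2)] cancels first, leaving [x1 S(x2)]. *)
  apply: eq_tlift => x1 x2.
  under eq_tlift => y1 y2 do rewrite amulA -[x1 ∙ y1 ∙ _]amulA.
  by rewrite -tlift_amull -tlift_amulr antipoder amulZr amul1r amulZl.
Qed.

(** The two sides are a left and a right convolution inverse of [comul], taken among the maps from
    [H] to the algebra [H ⊗ H]. *)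
Lemma comul_antipode h :
  comul (antipode h) = \tsum_(x, y <- comul h) (antipode y ⊗ antipode x).
Proof.
have ? := lS; have ? := lD.
apply: (conv_inverse_uniq (L := fun h => comul (antipode h)) (M := comul)
  (R := fun h => \tsum_(x, y <- comul h) (antipode y ⊗ antipode x))); try by slin.
- move=> d; rewrite -[𝟙]/(𝟙 ⊗ 𝟙) -comul1 -linearZ -antipodel lin_tlift //.
  by apply: eq_tlift => x y; rewrite comulM.
- move=> d.
  under eq_tlift => x y do rewrite tlift_amulr.
  rewrite -(comul_coassoc_tlift (F := fun x y z => comul x ∙ (antipode z ⊗ antipode y)));
    try by slin.
  (* The terms are [d_1 S(d_4) ⊗ d_2 S(d_3)]: the right leg collapses first, and then the left
     one. *)
  transitivity (\tsum_(x, y <- comul d) \tsum_(x1, x2 <- comul x)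
     \tsum_(u, v <- comul x1) ((u ∙ antipode y) ⊗ (v ∙ antipode x2))).
    apply: eq_tlift => x y; apply: eq_tlift => x1 x2.
    rewrite [LHS]/(_ ∙ _) /= /tmul; apply: eq_tlift => u v.
    by rewrite tlift_pure //; klin.
  transitivity (\tsum_(x, y <- comul d) ((x ∙ antipode y) ⊗ (𝟙 : H))).
    apply: eq_tlift => x y.
    rewrite (comul_coassoc_tlift (F := fun u v w =>
      (u ∙ antipode y) ⊗ (v ∙ antipode w))); try by slin.
    rewrite -(counitr_tlift (G := fun x => (x ∙ antipode y) ⊗ 𝟙)); last by klin.
    apply: eq_tlift => x1 x2; rewrite -(lin_tlift (g := pure _)); last by klin.
    by rewrite antipoder (linZ (f := pure _)) //; klin.
  rewrite -(lin_tlift (g := fun x => x ⊗ 𝟙)); last by klin.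
  by rewrite antipoder (linZ (f := fun x => x ⊗ 𝟙)) //; klin.
Qed.

Lemma comul_antipode_tlift (P : lmodType k) (F : H -> H -> P) h : kbilinear F ->
  \tsum_(u, v <- comul (antipode h)) (F u v) =
  \tsum_(x, y <- comul h) (F (antipode y) (antipode x)).
Proof. by move=> bF; rewrite comul_antipode tlift_tlift_pure. Qed.

End Antipode.

(** Supplies the bundled linear map that [k_split_epi] requires of a section. *)
Lemma linear_pack (k : comPzRingType) (U V : lmodType k) (f : U -> V) :
  linear f -> exists s : {linear U -> V}, s =1 f.
Proof.
move=> lf; pose s : {linear U -> V} := HB.pack f (GRing.isLinear.Build _ _ _ _ f lf).
by exists s.
Qed.

Lemma tensor3_eq (k : comPzRingType) (U V W P : lmodType k)
    (f g : (U ⊗ V) ⊗ W -> P) : linear f -> linear g ->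
  (forall u v w, f (u ⊗ v ⊗ w) = g (u ⊗ v ⊗ w)) -> f =1 g.
Proof.
move=> lf lg e; apply: tensor_eq => // s w; move: s.
by apply: tensor_eq => [||u v]; [by klin | by klin | exact: e].
Qed.

(** * From split epimorphisms to generators *)

Section Generators.
Context {k : comPzRingType} {H : hopfAlgType k}.
Variables (A : comodAlgType H) (C : modCoalgType H).

Lemma dk_hom_comp (X Y Z : dkMod A C) (f : Y -> Z) (g : X -> Y) :
  is_dk_hom f -> is_dk_hom g -> is_dk_hom (fun x => f (g x)).
Proof.
move=> [lf af cf] [lg ag cg]; split.
- exact: lin_comp.
- by move=> m a; rewrite ag af.
- by move=> m; rewrite cf cg tlift_tlift_pure //; klin.
Qed.

(** Action and coaction of [dk_tensor X V] touch only the factor [X]. *)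
Lemma dk_hom_pure (X : dkMod A C) (V : lmodType k) (v : V) :
  @is_dk_hom _ _ _ _ X (dk_tensor X V) (fun x => x ⊗ v).
Proof.
split=> [|x a|x] /=; first by klin.
- by rewrite dk_tensor_act_pure.
- by rewrite tens_coact_pure //; exact: dk_coact_comodule.
Qed.

(** Every [m] is [f (s m)], and [s m] is a sum of pure tensors [x ⊗ y]. On these [u] and [v] agree
    after [f], since [x ↦ f (x ⊗ y)] is a morphism from [X] to [M]. *)
Lemma generator_of_split_epi (X : dkMod A C) :
  (forall M : dkMod A C, exists f : dk_tensor X M -> M, k_split_epi f) ->
  is_generator X.
Proof.
move=> epi M N u v hu hv uv m; have [f [hf [s fs]]] := epi M.
rewrite -[m]fs; move: (s m).
apply: tensor_eq => [||x y].
- exact: lin_comp (dk_hom_linear hu) (dk_hom_linear hf).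
- exact: lin_comp (dk_hom_linear hv) (dk_hom_linear hf).
- exact: (uv _ (dk_hom_comp hf (dk_hom_pure X y))).
Qed.

End Generators.

(** * Sweedler rules for comodule algebras and module coalgebras *)

Section ComoduleAlgebra.
Context {k : comPzRingType} {H : hopfAlgType k}.
Variables (A : comodAlgType H) (C : modCoalgType H).

Lemma acoactM_tlift (P : lmodType k) (F : H -> A -> P) a b : kbilinear F ->
  \tsum_(u, v <- acoact (a ∙ b)) (F u v) =
  \tsum_(h, a0 <- acoact a) \tsum_(h', b0 <- acoact b) (F (h ∙ h') (a0 ∙ b0)).
Proof.
move=> bF; rewrite acoactM /tmul tlift_tlift //; apply: eq_tlift => x1 x2.
exact: tlift_tlift_pure.
Qed.

Lemma cact_comul_tlift (P : lmodType k) (F : C -> C -> P) c h : kbilinear F ->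
  \tsum_(u, v <- comul (cact c h)) (F u v) =
  \tsum_(c1, c2 <- comul c) \tsum_(h1, h2 <- comul h) (F (cact c1 h1) (cact c2 h2)).
Proof.
move=> bF; rewrite cact_comul tlift_tlift //; apply: eq_tlift => x1 x2.
exact: tlift_tlift_pure.
Qed.

End ComoduleAlgebra.

(** * The map defined by an integral: linearity, colinearity, section *)

Section IntegralMap.
Context {k : comPzRingType} {H : hopfAlgType k}.
Variables (A : comodAlgType H) (C : modCoalgType H).
Variables (g : C -> C -> A) (M : dkMod A C).
Hypothesis g_bil : kbilinear g.

Let cb := act_bilinear (@cact_module k H C).
Let mb := act_bilinear (dk_act_module M).
Let la := coact_linear (@acoact_comodule k H A).
Let lm := coact_linear (dk_coact_comodule M).
Let lS : linear (antipode : H -> H) := linearP _.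
Let lDH : linear (comul : H -> _) := linearP _.
Let lDC : linear (comul : C -> _) := linearP _.

(** The formula for [f] on pure tensors, with [g c d] in place of [γ(c)(d)]; being trilinear, it
    extends to the threefold tensor product as [integral_map]. *)
Definition integral_map3 (c : C) (a : A) (m : M) : M :=
  \tsum_(h, a0 <- acoact a) \tsum_(d, m0 <- dk_coact m)
    dk_act (dk_act m0 (g (cact c (antipode h)) d)) a0.

Definition integral_map (t : dk_tensor (dkCA A C) M) : M :=
  \tsum_(s, m <- t) \tsum_(c, a <- s) (integral_map3 c a m).

Ltac hyps := move: g_bil cb mb la lm lS lDH lDC => ? ? ? ? ? ? ? ?.

Lemma integral_map3_bilinear c : kbilinear (integral_map3 c).
Proof. rewrite /integral_map3; hyps; klin. Qed.

Lemma integral_map3_bilinear12 m : kbilinear (fun c a => integral_map3 c a m).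
Proof. rewrite /integral_map3; hyps; klin. Qed.

Lemma integral_map_bilinear :
  kbilinear (fun s m => \tsum_(c, a <- s) (integral_map3 c a m)).
Proof.
split=> [m|s]; first exact: tlift_linear (integral_map3_bilinear12 m).
apply: lin_tlift_fun => c a; exact: (integral_map3_bilinear c).2.
Qed.

Lemma integral_map_linear : linear integral_map.
Proof. exact: tlift_linear integral_map_bilinear. Qed.

Lemma integral_map_pure c a m : integral_map (c ⊗ a ⊗ m) = integral_map3 c a m.
Proof.
rewrite /integral_map tlift_pure ?tlift_pure //.
  exact: integral_map3_bilinear12.
exact: integral_map_bilinear.
Qed.

Lemma integral_map_act t b :
  integral_map (dk_act t b) = dk_act (integral_map t) b.
Proof.
have lf := integral_map_linear; have mbl := mb.1.
move: t; apply: tensor3_eq => [||c a m] /=.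
- exact: (lin_comp lf ((dk_tensor_act_bilinear (dkCA A C) _).1 b)).
- exact: (lin_comp (mb.1 b) lf).
rewrite dk_tensor_act_pure integral_map_pure /= dkCA_act_pure.
rewrite (lin_tlift (g := fun s => integral_map (s ⊗ m))); last first.
  by apply: (lin_comp lf); klin.
under eq_tlift => h b0 do rewrite integral_map_pure.
hyps.
(* Acting by [b] turns [c ⊗ a] into [c h ⊗ a b0]; the rule [S(h1 h2) = S(h2) S(h1)] then puts
   [S(h2)] next to [h]. *)
transitivity (\tsum_(h, b0 <- acoact b) \tsum_(h1, a0 <- acoact a)
   \tsum_(h2, b00 <- acoact b0) \tsum_(d, m0 <- dk_coact m)
    dk_act (dk_act m0 (g (cact c (h ∙ antipode h2 ∙ antipode h1)) d)) (a0 ∙ b00)).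
  apply: eq_tlift => h b0; rewrite /integral_map3 acoactM_tlift; last by slin.
  apply: eq_tlift => h1 a0; apply: eq_tlift => h2 b00; apply: eq_tlift => d m0.
  by rewrite antipodeM -amulA -(actA (@cact_module k H C)).
rewrite exchange_tlift [RHS](lin_tlift (g := fun m => dk_act m b)) //.
apply: eq_tlift => h1 a0.
(* Now [h] and [h2] become the halves of one coproduct, so that [h S(h2)] can collapse to a
   counit. *)
rewrite -(coassoc_tlift acoact_comodule (F := fun h h2 b0 =>
   \tsum_(d, m0 <- dk_coact m)
    dk_act (dk_act m0 (g (cact c (h ∙ antipode h2 ∙ antipode h1)) d)) (a0 ∙ b0)));
  try by slin.
transitivity (\tsum_(d, m0 <- dk_coact m)
    dk_act (dk_act m0 (g (cact c (antipode h1)) d)) (a0 ∙ b)); last first.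
  rewrite (lin_tlift (g := fun m => dk_act m b)) //.
  by apply: eq_tlift => d m0; rewrite (actA (dk_act_module M)).
rewrite -(counit_tlift acoact_comodule (G := fun b => \tsum_(d, m0 <- dk_coact m)
    dk_act (dk_act m0 (g (cact c (antipode h1)) d)) (a0 ∙ b))); last by slin.
apply: eq_tlift => h b0.
(* [K] isolates the dependence on [z = h S(h2)]; its linearity lets the antipode axiom act inside
   the sum. *)
pose K z := \tsum_(d, m0 <- dk_coact m)
    dk_act (dk_act m0 (g (cact c (z ∙ antipode h1)) d)) (a0 ∙ b0).
have lK : linear K by rewrite /K; slin.
rewrite -[LHS](lin_tlift _ _ lK) antipoder (linZ _ _ lK) /K.
by under eq_tlift => d m0 do rewrite amul1l.
Qed.

Hypothesis g_integral : forall c d : C,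
  \tsum_(c1, c2 <- comul c) (c1 ⊗ g c2 d) =
  \tsum_(d1, d2 <- comul d) \tsum_(h, a0 <- acoact (g c d1)) (cact d2 h ⊗ a0).

(** The integral identity read through a bilinear [F]: it trades the coaction of [g c d1] for the
    coproduct of [c]. *)
Lemma integral_tlift (P : lmodType k) (F : C -> A -> P) c d : kbilinear F ->
  \tsum_(d1, d2 <- comul d) \tsum_(h, a0 <- acoact (g c d1)) (F (cact d2 h) a0) =
  \tsum_(c1, c2 <- comul c) (F c1 (g c2 d)).
Proof.
move=> bF; rewrite -(tlift_tlift_pure _ _ _ bF) g_integral tlift_tlift //.
by apply: eq_tlift => d1 d2; rewrite tlift_tlift_pure.
Qed.

Lemma dk_coact_act2 (m : M) x a :
  dk_coact (dk_act (dk_act m x) a) =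
  \tsum_(e, m0 <- dk_coact m) \tsum_(p, x0 <- acoact x) \tsum_(q, a0 <- acoact a)
    (cact (cact e p) q ⊗ dk_act (dk_act m0 x0) a0).
Proof.
hyps; rewrite dk_compat dk_compat tlift_tlift; last by slin.
by apply: eq_tlift => e m0; rewrite tlift_tlift_pure //; slin.
Qed.

Lemma dk_coact_integral_map3 c a m :
  dk_coact (integral_map3 c a m) =
  \tsum_(c1, c2 <- comul c) (c1 ⊗ integral_map3 c2 a m).
Proof.
hyps.
transitivity (\tsum_(h, a0 <- acoact a) \tsum_(d, m0 <- dk_coact m)
  \tsum_(c1, c2 <- comul (cact c (antipode h))) \tsum_(q, a1 <- acoact a0)
    (cact c1 q ⊗ dk_act (dk_act m0 (g c2 d)) a1)).
  rewrite lin_tlift //; apply: eq_tlift => h a0; rewrite lin_tlift //.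
  under eq_tlift => d m0 do rewrite dk_coact_act2.
  (* The two coaction indices of [m] become the halves of one coproduct, which is the shape that the
     integral identity needs. *)
  rewrite -(coassoc_tlift (dk_coact_comodule M) (F := fun d e m1 =>
    \tsum_(p, x0 <- acoact (g (cact c (antipode h)) d))
      \tsum_(q, a1 <- acoact a0)
      (cact (cact e p) q ⊗ dk_act (dk_act m1 x0) a1))); try by slin.
  apply: eq_tlift => d m0.
  rewrite (integral_tlift (F := fun e x => \tsum_(q, a1 <- acoact a0)
      (cact e q ⊗ dk_act (dk_act m0 x) a1))) //; slin.
transitivity (\tsum_(c1, c2 <- comul c) \tsum_(d, m0 <- dk_coact m)
  \tsum_(h, a0 <- acoact a)
    (c1 ⊗ dk_act (dk_act m0 (g (cact c2 (antipode h)) d)) a0)); last first.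
  apply: eq_tlift => c1 c2; rewrite /integral_map3 exchange_tlift.
  rewrite (lin_tlift (g := pure _)); last by klin.
  by apply: eq_tlift => d m0; rewrite (lin_tlift (g := pure _)) //; klin.
rewrite exchange_tlift [RHS]exchange_tlift; apply: eq_tlift => d m0.
under eq_tlift => h a0 do rewrite exchange_tlift.
(* Likewise [h], which sits under the antipode, and [q], which acts on [c1], become the halves of
   one coproduct. *)
rewrite -(coassoc_tlift acoact_comodule (F := fun h q a1 =>
  \tsum_(c1, c2 <- comul (cact c (antipode h)))
    (cact c1 q ⊗ dk_act (dk_act m0 (g c2 d)) a1))); try by slin.
rewrite [RHS]exchange_tlift; apply: eq_tlift => h a0.
(* Since the antipode reverses coproducts, [c1] receives [S(v)] and [c2] receives [S(u)]. Thus
   [S(v)] meets [q], its neighbour in the iterated coproduct [u ⊗ v ⊗ q], and the two cancel after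
   regrouping. *)
transitivity (\tsum_(c1, c2 <- comul c) \tsum_(h1, q <- comul h)
  \tsum_(u, v <- comul h1) (cact c1 (antipode v ∙ q) ⊗
     dk_act (dk_act m0 (g (cact c2 (antipode u)) d)) a0)).
  rewrite exchange_tlift; apply: eq_tlift => h1 q.
  rewrite cact_comul_tlift; last by slin.
  apply: eq_tlift => c1 c2; rewrite comul_antipode_tlift; last by slin.
  by apply: eq_tlift => u v; rewrite (actA (@cact_module k H C)).
apply: eq_tlift => c1 c2.
rewrite (comul_coassoc_tlift (F := fun u v q => cact c1 (antipode v ∙ q) ⊗
     dk_act (dk_act m0 (g (cact c2 (antipode u)) d)) a0)); try by slin.
rewrite -[RHS](counitr_tlift (G := fun h => c1 ⊗
     dk_act (dk_act m0 (g (cact c2 (antipode h)) d)) a0)); last by slin.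
apply: eq_tlift => u w.
pose K z := cact c1 z ⊗ dk_act (dk_act m0 (g (cact c2 (antipode u)) d)) a0.
have lK : linear K by rewrite /K; slin.
rewrite -[LHS](lin_tlift _ _ lK) antipodel (linZ _ _ lK) /K.
by rewrite (act1 (@cact_module k H C)).
Qed.

Lemma integral_map_hom : is_dk_hom integral_map.
Proof.
have lf := integral_map_linear; have lm' := lm.
have CAco := tens_coact_comodule A (comul_comodule C).
split=> [//||]; first exact: integral_map_act.
have lt := tens_coact_linear (V := M) CAco.
apply: tensor3_eq => [||c a m] /=.
- by klin.
- apply: lin_tlift_arg => //; klin.
rewrite integral_map_pure dk_coact_integral_map3.
rewrite tens_coact_pure // tens_coact_pure; last exact: comul_comodule.
rewrite tlift_tlift_pure; last by klin.
rewrite tlift_tlift_pure.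
  by apply: eq_tlift => c1 c2; rewrite integral_map_pure.
by split=> ?; klin; apply: (lin_comp lf); klin.
Qed.

Hypothesis g_total : forall c : C, \tsum_(c1, c2 <- comul c) (g c1 c2) = counit c *: 𝟙.

(** At [a = 𝟙] the coaction and the antipode are trivial, which leaves [m_<0> γ(m_<-2>)(m_<-1>)];
    coassociativity and totality reduce this to the counit law of [M]. *)
Lemma integral_map_section (m : M) :
  integral_map (\tsum_(d, m0 <- dk_coact m) (d ⊗ 𝟙 ⊗ m0)) = m.
Proof.
hyps; rewrite (lin_tlift _ _ integral_map_linear).
transitivity (\tsum_(d, m0 <- dk_coact m) \tsum_(e, m1 <- dk_coact m0)
   (dk_act m1 (g d e))).
  apply: eq_tlift => d m0; rewrite integral_map_pure /integral_map3.
  rewrite acoact1 tlift_pure; last by slin.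
  apply: eq_tlift => e m1; rewrite antipode1 (act1 (dk_act_module M)).
  by rewrite (act1 (@cact_module k H C)).
rewrite -(coassoc_tlift (dk_coact_comodule M) (F := fun d e m1 =>
  dk_act m1 (g d e))); try by slin.
rewrite -[RHS](coact_counit (dk_coact_comodule M)); apply: eq_tlift => c m0.
rewrite -(lin_tlift (g := dk_act m0)); last exact: mb.2.
by rewrite g_total (linZ _ _ (mb.2 m0)) (act1 (dk_act_module M)).
Qed.

Lemma integral_map_split : k_split_epi integral_map.
Proof.
hyps; split; first exact: integral_map_hom.
have [] := linear_pack (f := fun m : M =>
  \tsum_(d, m0 <- dk_coact m) (d ⊗ 𝟙 ⊗ m0 : C ⊗ A ⊗ M)); first by klin.
by move=> s es; exists s => m; rewrite es integral_map_section.
Qed.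

End IntegralMap.

Theorem theorem3p9 (k : comPzRingType) (H : hopfAlgType k)
    (A : comodAlgType H) (C : modCoalgType H)
    (γ : C -> {linear C -> A}) (γ_int : is_integral γ) (γ_tot : is_total γ) :
  (forall M : dkMod A C,
     exists f : dk_tensor (dkCA A C) M -> M,
       (forall (c : C) (a : A) (m : M),
          f (c ⊗ a ⊗ m) =
          \tsum_(h, a0 <- acoact a) \tsum_(d, m0 <- dk_coact m)
            dk_act (dk_act m0 (γ (cact c (antipode h)) d)) a0)
       /\ k_split_epi f)
  /\ is_generator (dkCA A C).
Proof.
(* [g] forgets that each [γ c] is a bundled linear map; linearity in both arguments is restated as
   bilinearity. *)
pose g c d : A := γ c d.
have g_bil : kbilinear g.
  by split=> [d|c]; [exact: (integral_linear γ_int) | exact: linearP].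
have epi (M : dkMod A C) : k_split_epi (integral_map g (M := M)).
  exact: integral_map_split (integralP γ_int) γ_tot.
split=> [M|]; last by apply: generator_of_split_epi => M; exists (integral_map g (M := M)).
exists (integral_map g (M := M)); split=> // c a m.
exact: integral_map_pure.
Qed.
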